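(* Let $L=[0,+\infty]$, let $n\geqslant 1$, let $p:L^n\to L$ be a weighted lattice polynomial function, and let $X_1,\ldots,X_n$ be independent nonnegative random variables (component lifetimes) with reliabilities $r_i(t):=\Pr[X_i>t]$, $t>0$. Put $Y_p:=p(X_1,\ldots,X_n)$. If $r_i(t)=e^{-\lambda_i t}$ (with $\lambda_i>0$) for all $i\in [n]$, then $$\mathbf{E}[Y_p]=p(\mathbf{e}_{\varnothing})+\sum_{\substack{S\subseteq [n]\\ S\neq\varnothing}} \; \sum_{T\subseteq S} (-1)^{|S|-|T|}\, \frac{1-e^{-\lambda(S)\, p(\mathbf{e}_T)}}{\lambda(S)},$$ where $\lambda(S):=\sum_{i\in S}\lambda_i$.
   Context: Notation: $[n]=\{1,\ldots,n\}$; $\wedge=\min$, $\vee=\max$. The class of weighted lattice polynomial functions from $L^n$ to $L$ is the smallest class of functions $L^n\to L$ that contains all projections $(x_1,\ldots,x_n)\mapsto x_k$ ($k\in[n]$) and all constant functions $(x_1,\ldots,x_n)\mapsto c$ ($c\in L$), and is closed under pointwise $\wedge$ and pointwise $\vee$. For $S\subseteq[n]$, $\mathbf{e}_S$ is the vector in $\{0,+\infty\}^n$ whose $i$th component is $+\infty$ if $i\in S$ and $0$ otherwise. Convention: $e^{-\infty}=0$. *)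

(* Defs.v *)
From HB Require Import structures.
From mathcomp Require Import all_boot all_order all_algebra.
From mathcomp Require Import all_classical all_reals all_analysis measurable_realfun.

Set Implicit Arguments.
Unset Strict Implicit.
Unset Printing Implicit Defensive.

Import Order.TTheory GRing.Theory Num.Theory.
Import numFieldNormedType.Exports.

Local Open Scope classical_set_scope.
Local Open Scope ring_scope.
Local Open Scope ereal_scope.

(* [lattice R] is the chain [0, +oo] with both endpoints included: despite its
   name, [{nonneg \bar R}] contains +oo (and not only the finite reals).  Its
   order is the one induced by \bar R, so that the lattice operations are
   [Order.min] and [Order.max]. *)
Notation lattice R := {nonneg \bar R}.

Section lattice_polynomials.
Variables (R : realType) (n : nat).

Inductive weighted_lattice_polynomial :
    (('I_n -> lattice R) -> lattice R) -> Prop :=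
  | wlp_proj (k : 'I_n) : weighted_lattice_polynomial (fun x => x k)
  | wlp_const (c : lattice R) : weighted_lattice_polynomial (fun=> c)
  | wlp_min f g : weighted_lattice_polynomial f ->
      weighted_lattice_polynomial g ->
      weighted_lattice_polynomial (fun x => Order.min (f x) (g x))
  | wlp_max f g : weighted_lattice_polynomial f ->
      weighted_lattice_polynomial g ->
      weighted_lattice_polynomial (fun x => Order.max (f x) (g x)).

Definition evec (S : {set 'I_n}) : 'I_n -> lattice R :=
  fun i => if i \in S then +oo%:nng else 0%:E%:nng.

End lattice_polynomials.

Section lifetimes.
Context d (T : measurableType d) (R : realType) (P : probability T R).

Definition reliability (X : T -> lattice R) (t : R) : \bar R :=
  P [set w | t%:E < (X w)%:num].

(* Mutual independence: the product rule is required for every subfamily. *)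
Definition mutually_independent d' (T' : measurableType d') (I : finType)
    (X : I -> T -> T') : Prop :=
  forall (J : {set I}) (A : I -> set T'),
    (forall i, measurable (A i)) ->
    P (\bigcap_(i in [set` J]) (X i @^-1` A i))
    = \prod_(i in J) P (X i @^-1` A i).

(* The library's ['E_P[_]] only applies to real-valued functions. *)
Definition expectation_ext (Y : T -> lattice R) : \bar R :=
  \int[P]_w (Y w)%:num.

End lifetimes.

(* Main.v *)
(* Whether p(x) > t depends only on A = {i | x_i > t}, and it holds iff
   p(e_A) > t.  Moebius inversion over subsets therefore writes the indicator
   of {Y_p > t} as a combination of the indicators of {min_(i in S) X_i > t},
   whose probability is exp(- lambda(S) t) by independence.  The result follows
   by integrating Pr[Y_p > t] over t > 0.  The term p(e_set0) comes from S = set0;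
   when it is infinite, Y_p is constantly +oo and both sides are +oo. *)

Require Import Defs.
From HB Require Import structures.
From mathcomp Require Import all_boot all_order all_algebra.
From mathcomp Require Import all_classical all_reals all_analysis measurable_realfun.

Set Implicit Arguments.
Unset Strict Implicit.
Unset Printing Implicit Defensive.

Import Order.TTheory GRing.Theory Num.Theory.
Import numFieldNormedType.Exports.

Local Open Scope classical_set_scope.
Local Open Scope ring_scope.
Local Open Scope ereal_scope.

(** * Order properties of weighted lattice polynomials *)

Section wlp.
Variables (R : realType) (n : nat).

Lemma lattice_ge0 (a : lattice R) : 0 <= a%:num :> \bar R.
Proof. exact: ge0e. Qed.

Lemma num_mine (a b : lattice R) :
  (Order.min a b)%:num = mine a%:num b%:num :> \bar R.
Proof. by rewrite !minEle -fun_if; case: ifP. Qed.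

Lemma num_maxe (a b : lattice R) :
  (Order.max a b)%:num = maxe a%:num b%:num :> \bar R.
Proof. by rewrite !maxEle -fun_if; case: ifP. Qed.

Implicit Types (p : ('I_n -> lattice R) -> lattice R) (x : 'I_n -> lattice R).

(** The vector [evec R set0] is the bottom of L^n, and min and max are monotone. Used when this
    bottom value is infinite, to force Y_p to be constant. *)
Lemma wlp_evec0_le p x : weighted_lattice_polynomial p ->
  (p (evec R finset.set0))%:num <= (p x)%:num.
Proof.
have le_min2 (a b a' b' : lattice R) : a%:num <= a'%:num -> b%:num <= b'%:num ->
    (Order.min a b)%:num <= (Order.min a' b')%:num.
  by move=> aa' bb'; rewrite !num_mine le_min !ge_min aa' bb' orbT.
have le_max2 (a b a' b' : lattice R) : a%:num <= a'%:num -> b%:num <= b'%:num ->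
    (Order.max a b)%:num <= (Order.max a' b')%:num.
  by move=> aa' bb'; rewrite !num_maxe ge_max !le_max aa' bb' orbT.
elim=> [k|c|f g _ IHf _ IHg|f g _ IHf _ IHg].
- by rewrite /evec finset.in_set0; exact: lattice_ge0.
- exact: lexx.
- exact: le_min2.
- exact: le_max2.
Qed.

(** Thresholding a chain at [t] is a lattice morphism to the booleans, so min and max commute with
    it. At a projection, 0 and +oo fall on the right sides of the threshold because 0 <= t < +oo. *)
Lemma wlp_lt_evec p x (t : R) : weighted_lattice_polynomial p -> (0 <= t)%R ->
  (t%:E < (p x)%:num) =
  (t%:E < (p (evec R [set i | t%:E < (x i)%:num]%SET))%:num).
Proof.
have lt_min2 (s : \bar R) (a b a' b' : lattice R) :
    (s < a%:num) = (s < a'%:num) -> (s < b%:num) = (s < b'%:num) ->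
    (s < (Order.min a b)%:num) = (s < (Order.min a' b')%:num).
  by move=> aa' bb'; rewrite !num_mine !lt_min aa' bb'.
have lt_max2 (s : \bar R) (a b a' b' : lattice R) :
    (s < a%:num) = (s < a'%:num) -> (s < b%:num) = (s < b'%:num) ->
    (s < (Order.max a b)%:num) = (s < (Order.max a' b')%:num).
  by move=> aa' bb'; rewrite !num_maxe !lt_max aa' bb'.
move=> + t0; elim=> [k|c|f g _ IHf _ IHg|f g _ IHf _ IHg].
- rewrite /evec finset.in_set; case: (t%:E < _) => /=.
    by rewrite ltry.
  by rewrite lte_fin ltNge t0.
- by [].
- exact: lt_min2.
- exact: lt_max2.
Qed.

Lemma measurable_wlp d (T : measurableType d) p (X : 'I_n -> T -> lattice R) :
  weighted_lattice_polynomial p ->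
  (forall i, measurable_fun setT (fun w => (X i w)%:num : \bar R)) ->
  measurable_fun setT (fun w => (p (X ^~ w))%:num : \bar R).
Proof.
move=> + mX; elim=> [k|c|f g _ IHf _ IHg|f g _ IHf _ IHg].
- exact: mX.
- exact: measurable_cst.
- by under eq_fun do rewrite num_mine; exact: measurable_mine.
- by under eq_fun do rewrite num_maxe; exact: measurable_maxe.
Qed.
End wlp.

(** * Moebius inversion on the lattice of subsets *)

Section mobius.
Variables (K : numDomainType) (I : finType).
Implicit Types (A S U : {set I}) (h : {set I} -> K).
Local Open Scope ring_scope.

(** These are the coefficients of the multilinear polynomial that represents the set function
    [h]. *)
Definition mobius h S : K :=
  \sum_(U : {set I} | U \subset S) (-1) ^+ (#|S| - #|U|) * h U.

(* Toggling an element x of A minus U in S is a sign-reversing involution on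
   the interval [U, A]. *)
Lemma sum_sign_itv A U : U \subset A ->
  \sum_(S : {set I} | (U \subset S) && (S \subset A)) (-1) ^+ (#|S| - #|U|)
  = (U == A)%:R :> K.
Proof.
move=> UA; have [->|UneA] := eqVneq U A.
  rewrite (big_pred1 A) ?subnn// => S.
  by rewrite /= andbC -finset.eqEsubset.
have /properP[_ [x xA xU]] : U \proper A.
  by rewrite finset.properEneq UneA UA.
pose f S := if x \in S then (S :\ x)%SET else (x |: S)%SET.
have fK : involutive f.
  move=> S; rewrite /f; have [xS|xS] := boolP (x \in S).
    by rewrite finset.setD11 finset.setD1K.
  by rewrite finset.setU11 finset.setU1K.
set s := LHS.
(* In a [numDomainType] only 0 equals its own opposite. *)
suff : s = - s by move=> sN; apply/eqP; rewrite -eqNr -sN.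
rewrite {1}/s (reindex_inj (inv_inj fK)) /s -sumrN.
have fE S : (U \subset f S) && (f S \subset A) = (U \subset S) && (S \subset A).
  rewrite /f; case: ifPn => xS.
    by rewrite finset.subsetD1 xU andbT finset.subDset finset.setUC
      (finset.setUidPl _) ?finset.sub1set.
  rewrite finset.subUset finset.sub1set xA /=; congr (_ && _).
  apply/idP/idP => [/fintype.subsetP US|US];
    last exact: (fintype.subset_trans US (finset.subsetUr _ _)).
  apply/fintype.subsetP => y yU; have := US _ yU; rewrite !finset.inE.
  by case: eqP => // yx; rewrite -yx yU in xU.
apply: eq_big => S; first exact: fE.
rewrite fE => /andP[US SA].
have US' : U \subset f S by have := fE S; rewrite US SA => /andP[].
(* Since [U] lies in both [S] and [f S], neither subtraction truncates, and the sign depends only on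
   the parity of the cardinal. *)
rewrite -[LHS]signr_odd -[in RHS]signr_odd !oddB ?subset_leq_card//.
suff -> : odd #|f S| = ~~ odd #|S|.
  by rewrite addNb; case: (odd _ (+) odd _); rewrite /= ?expr1 ?opprK.
rewrite /f; case: ifPn => xS.
  by rewrite (finset.cardsD1 x S) xS /= negbK.
by rewrite finset.cardsU1 xS /=.
Qed.

(** After exchanging the sums, the coefficient of [h U] is the signed sum over the interval [U, A],
    which survives only for U = A. *)
Lemma mobius_inversion h A :
  h A = \sum_(S : {set I}) mobius h S * (S \subset A)%:R.
Proof.
transitivity (\sum_(S : {set I} | S \subset A) mobius h S); last first.
  rewrite big_mkcond /=; apply: eq_bigr => S _.
  by case: ifP; rewrite ?mulr1 ?mulr0.
rewrite /mobius (exchange_big_dep (fun U : {set I} => U \subset A)) /=;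
  last first.
  by move=> S U SA US; exact: fintype.subset_trans US SA.
rewrite (bigD1 A)//= [X in _ + X]big1 => [|U /andP[UA UneA]];
  rewrite -mulr_suml.
  under eq_bigl do rewrite andbC.
  by rewrite sum_sign_itv// eqxx mul1r addr0.
under eq_bigl do rewrite andbC.
by rewrite sum_sign_itv// (negbTE UneA) mul0r.
Qed.
End mobius.

(** * The mean as the integral of the tail *)

Section layer_cake.
Context d (T : measurableType d) (R : realType).
Variable m : {sigma_finite_measure set T -> \bar R}.
Let mu : {measure set _ -> \bar R} := @lebesgue_measure R.

(** Tonelli for the region 0 < t < f x under the graph: its sections at [x] have length [f x], its
    sections at [t] are the tail events. *)
Lemma ge0_integral_tail (f : T -> \bar R) : measurable_fun setT f ->
  (forall x, 0 <= f x) ->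
  \int[m]_x f x = \int[mu]_(t in `]0%R, +oo[) m [set x | t%:E < f x].
Proof.
move=> mf f0.
pose A : set (T * measurableTypeR R) := [set z | (0 < z.2)%R /\ z.2%:E < f z.1].
have mA : measurable A.
  have -> : A = ([set z : T * measurableTypeR R | 0 < z.2%:E]
     `&` [set z | z.2%:E < f z.1]).
    by apply/seteqP; split => z [].
  have mz2 :
      measurable_fun setT (fun z : T * measurableTypeR R => z.2%:E : \bar R).
    by apply/measurable_EFinP; exact: measurable_snd.
  apply: measurableI.
    by rewrite -[X in measurable X]setTI; exact: measurable_lte.
  rewrite -[X in measurable X]setTI; apply: measurable_lte => //.
  exact: measurableT_comp.
have := indic_fubini_tonelli m mu mA.
rewrite indic_fubini_tonelli_FE// indic_fubini_tonelli_GE// => H.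
transitivity (\int[m]_x (mu \o xsection A) x).
  apply: eq_integral => x _ /=.
  have -> : xsection A x = [set t : R | (0 < t)%R /\ t%:E < f x].
    by apply/seteqP; split => t; rewrite /xsection /= ?inE.
  (* The section is an interval of length [r], or the whole positive half-line when [f x] is
     infinite. *)
  have := f0 x; case: (f x) => [r|_|//].
    rewrite lee_fin => r0.
    rewrite (_ : [set t | _] = `]0%R, r[%classic).
      rewrite /mu lebesgue_measure_itv /= lte_fin.
      by case: ltgtP r0 => // [_ _|<-]; rewrite ?sube0.
    by apply/seteqP; split => t /=; rewrite in_itv /= lte_fin => /andP.
  rewrite (_ : [set t | _] = `]0%R, +oo[%classic).
    by rewrite /mu lebesgue_measure_itv /= ltry.
  by apply/seteqP; split => t /=; rewrite in_itv /= ltry andbT // => -[].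
rewrite H [RHS]integral_mkcond; apply: eq_integral => t _ /=.
rewrite patchE; case: ifPn; rewrite ?inE ?notin_setE /= in_itv /= andbT => t0.
  by congr (m _); apply/seteqP; split => x; rewrite /ysection /= inE //= => -[].
rewrite (_ : ysection _ _ = set0) ?measure0//.
by apply/seteqP; split => x //; rewrite /ysection /= inE /A /= => -[].
Qed.
End layer_cake.

(** * Integrals of exponentials cut off at a level in [0, +oo] *)

Section truncated_exponential.
Variable R : realType.
Let mu : {measure set _ -> \bar R} := @lebesgue_measure R.

Definition lt_set (c : \bar R) : set R := [set t | t%:E < c].

Lemma measurable_lt_set (c : \bar R) : measurable (lt_set c).
Proof. by rewrite -[X in measurable X]setTI; exact: measurable_lte. Qed.

(** The rate-zero case, where dividing by the rate is impossible; it produces the term for S =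
    set0. *)
Lemma integral_indic_lt_set (c : \bar R) : 0 <= c ->
  \int[mu]_(t in `]0%R, +oo[) (\1_(lt_set c) t)%:E = c.
Proof.
move=> c0; rewrite integral_indic//; last exact: measurable_lt_set.
case: c c0 => [r|_|//].
  rewrite lee_fin => r0; rewrite (_ : _ `&` _ = `]0%R, r[%classic).
    rewrite /= lebesgue_measure_itv /= lte_fin.
    by case: ltgtP r0 => // [_ _|<-]; rewrite ?sube0.
  apply/seteqP; split => t /=; rewrite /lt_set /= !in_itv /= lte_fin andbT.
    by move=> [-> ->].
  by move=> /andP[].
rewrite (_ : _ `&` _ = `]0%R, +oo[%classic).
  by rewrite /= lebesgue_measure_itv /= ltry.
by apply/seteqP; split => t /=; rewrite /lt_set /= ltry //= => -[].
Qed.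

(** The integrand is 1/l times the exponential density cut off at [c], so the integral is the
    exponential distribution function at [c] divided by [l]. *)
Lemma integral_expR_lt_set (l : R) (c : \bar R) : (0 < l)%R -> 0 <= c ->
  \int[mu]_(t in `]0%R, +oo[)
    (\1_(lt_set c) t * expR (- (l * t)))%:E
  = (1 - expeR (- (l%:E * c))) / l%:E.
Proof.
move=> l0 c0.
have mpdf : measurable_fun setT (EFin \o exponential_pdf l).
  by apply/measurable_EFinP; exact: measurable_exponential_pdf.
transitivity (\int[mu]_(t in `]0%R, +oo[ `&` lt_set c)
    (l^-1%:E * (exponential_pdf l t)%:E)).
  rewrite integral_mkcondr; apply: eq_integral => t.
  rewrite inE /= in_itv /= andbT => t0; rewrite patchE indicE.
  case: ifPn => _; rewrite ?mul0r// mul1r -EFinM exponential_pdfE ?ltW//.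
  by rewrite mulKf ?gt_eqF// mulNr.
rewrite ge0_integralZl_EFin//; first last.
- by rewrite invr_ge0 ltW.
- exact: measurable_funTS.
- by move=> t _; rewrite lee_fin exponential_pdf_ge0// ltW.
- by apply: measurableI => //; exact: measurable_lt_set.
rewrite inver gt_eqF// muleC; congr (_ * _).
case: c c0 => [r|_|//].
  rewrite lee_fin => r0; rewrite (_ : _ `&` _ = `]0%R, r[%classic); last first.
    apply/seteqP; split => t /=; rewrite /lt_set /= !in_itv /= lte_fin andbT.
      by move=> [-> ->].
    by move=> /andP[].
  move: r0; rewrite le_eqVlt => /predU1P[<-|r0].
    by rewrite set_itv_ge ?bnd_simp ?ltxx// integral_set0 mule0 oppe0
      expeR0 subee.
  (* Adding the two endpoints changes nothing and gives the closed interval of the known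
     distribution function. *)
  rewrite -(@integral_itv_bndoo _ _ _ _ true false).
    by rewrite -/(exponential_prob l _) exponential_prob_itv0c//= mulNr.
  exact: measurable_funTS.
(* For infinite [c], [expeR] vanishes at -oo, and the remaining 1 is the total mass of the density,
   which is zero on negative reals. *)
rewrite gt0_muley ?lte_fin//= sube0 -[RHS](integral_exponential_pdf l0).
rewrite (_ : _ `&` _ = `]0%R, +oo[%classic); last first.
  by apply/seteqP; split => t /=; rewrite /lt_set /= ltry //= => -[].
rewrite integral_itv_obnd_cbnd; last exact: measurable_funTS.
rewrite integral_mkcond; apply: eq_integral => t _; rewrite patchE.
case: ifPn => //; rewrite notin_setE /= in_itv /= andbT => /negP.
by rewrite -ltNge => t0; rewrite lt0_exponential_pdf.
Qed.

Lemma integrable_ge0_fin (D : set R) (f : R -> R) : measurable D ->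
  measurable_fun D f -> (forall t, D t -> (0 <= f t)%R) ->
  \int[mu]_(t in D) (f t)%:E \is a fin_num -> mu.-integrable D (EFin \o f).
Proof.
move=> mD mf f0 ffin; apply/integrableP; split; first exact/measurable_EFinP.
have -> : \int[mu]_(t in D) `|(EFin \o f) t| = \int[mu]_(t in D) (f t)%:E.
  apply: eq_integral => t; rewrite inE => Dt /=.
  by rewrite ger0_norm ?f0.
by rewrite ltey_eq ffin.
Qed.

(** The exponent is never +oo, so the exponential is finite even when [c] is infinite. *)
Lemma fin_num_expeR_quot (l : R) (c : \bar R) : (0 < l)%R -> 0 <= c ->
  (1 - expeR (- (l%:E * c))) / l%:E \is a fin_num.
Proof.
move=> l0 c0; rewrite inver gt_eqF//; apply: fin_numM => //.
by case: c c0 => [r|_|//] //; rewrite gt0_muley.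
Qed.

Lemma integrable_expR_lt_set (l : R) (c : \bar R) : (0 < l)%R -> 0 <= c ->
  mu.-integrable `]0%R, +oo[
    (fun t => (\1_(lt_set c) t * expR (- (l * t)))%:E).
Proof.
move=> l0 c0; apply: (@integrable_ge0_fin _
    (fun t => \1_(lt_set c) t * expR (- (l * t)))%R) => //.
- apply: measurable_funM.
    by apply: measurable_indic; exact: measurable_lt_set.
  by apply: measurableT_comp => //; exact: measurableT_comp.
- by rewrite integral_expR_lt_set// fin_num_expeR_quot.
Qed.
End truncated_exponential.

(** * Expansion of the survival function of Y_p *)

Section survival.
Context d (T : measurableType d) (R : realType) (P : probability T R).
Variables (n : nat) (p : ('I_n -> lattice R) -> lattice R).
Hypothesis p_wlp : weighted_lattice_polynomial p.
Variable X : 'I_n -> T -> lattice R.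
Hypothesis X_meas :
  forall i, measurable_fun setT (fun w => (X i w)%:num : \bar R).

(** In reliability terms, the structure function at time [t]: whether the system works when exactly
    the components in [S] do. *)
Definition signature (t : R) (S : {set 'I_n}) : R :=
  \1_(lt_set (p (evec R S))%:num) t.

(** Moebius inversion is applied pointwise at the random set of components alive at [t]; taking
    expectations turns indicators into probabilities. *)
Lemma wlp_tail (t : R) : (0 <= t)%R ->
  P [set w | t%:E < (p (X ^~ w))%:num] =
  \sum_(S : {set 'I_n}) (mobius (signature t) S)%:E *
    P (\bigcap_(i in [set` S]) [set w | t%:E < (X i w)%:num]).
Proof.
move=> t0.
have mX i : measurable [set w | t%:E < (X i w)%:num].
  by rewrite -[X in measurable X]setTI; exact: emeasurable_fun_o_infty.
pose B (S : {set 'I_n}) :=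
  \bigcap_(i in [set` S]) [set w | t%:E < (X i w)%:num].
have mcap (S : {set 'I_n}) : measurable (B S).
  by apply: fin_bigcap_measurable => //; exact: finite_finset.
have mY : measurable [set w | t%:E < (p (X ^~ w))%:num].
  rewrite -[X in measurable X]setTI; apply: emeasurable_fun_o_infty => //.
  exact: measurable_wlp.
rewrite -[LHS](congr1 P (setIT _)) -integral_indic//.
transitivity (\int[P]_w \sum_(S : {set 'I_n}) (mobius (signature t) S)%:E *
    (\1_(B S) w)%:E).
  apply: eq_integral => w _.
  under eq_bigr do rewrite -EFinM.
  rewrite sumEFin; congr EFin.
  pose A := [set i | t%:E < (X i w)%:num]%SET.
  transitivity (signature t A).
    rewrite /signature /lt_set !indicE; congr (_ %:R); congr nat_of_bool.
    have E := wlp_lt_evec (X ^~ w) p_wlp t0.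
    apply/idP/idP => /set_mem H; apply: mem_set.
      exact: etrans (esym E) H.
    exact: etrans E H.
  (* The inclusion of [S] in the set [A] of live components is the event [B S]. *)
  rewrite mobius_inversion; apply: eq_bigr => S _; congr (_ * _)%R.
  rewrite indicE; congr (_ %:R); congr nat_of_bool; apply/idP/idP.
    by move=> /fintype.subsetP SA; apply: mem_set => i /SA;
      rewrite finset.in_set.
  by move=> /set_mem SA; apply/fintype.subsetP => i iS;
    rewrite finset.in_set; exact: SA.
rewrite integral_sum//; last first.
  by move=> S; apply: integrableZl => //; exact: integrable_indic.
apply: eq_bigr => S _; rewrite integralZl//; last exact: integrable_indic.
by rewrite integral_indic// setIT.
Qed.
End survival.

(** A series system lives as long as all its components: independence gives a product of
    exponentials, whose rates add up. *)
Lemma reliability_series d (T : measurableType d) (R : realType)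
    (P : probability T R) (I : finType) (X : I -> T -> lattice R)
    (lambda : I -> R) (S : {set I}) (t : R) :
  mutually_independent P (fun i w => (X i w)%:num : \bar R) ->
  (forall i, reliability P (X i) t = (expR (- (lambda i * t)))%:E) ->
  P (\bigcap_(i in [set` S]) [set w | t%:E < (X i w)%:num])
  = (expR (- ((\sum_(i in S) lambda i) * t)))%:E.
Proof.
move=> Xind Xexp.
have mlt : measurable [set x : \bar R | t%:E < x].
  by rewrite -[X in measurable X]setTI; exact: emeasurable_fun_o_infty.
have := Xind S (fun=> [set x : \bar R | t%:E < x]) (fun=> mlt).
rewrite /preimage /= => ->.
under eq_bigr do rewrite -/(reliability P (X _) t) Xexp.
rewrite prodEFin -expR_sum; congr (expR _)%:E.
by rewrite mulr_suml sumrN.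
Qed.

(** * Termwise integration of the survival function *)

Theorem proposition14 (R : realType) (d : measure_display)
    (Omega : measurableType d) (P : probability Omega R)
    (n : nat) (n_ge1 : (1 <= n)%N)
    (p : ('I_n -> lattice R) -> lattice R)
    (p_wlp : weighted_lattice_polynomial p)
    (X : 'I_n -> Omega -> lattice R)
    (X_meas : forall i, measurable_fun setT (fun w => (X i w)%:num : \bar R))
    (X_indep : mutually_independent P
                 (fun (i : 'I_n) w => (X i w)%:num : \bar R))
    (lambda : 'I_n -> R) (lambda_gt0 : forall i, (0 < lambda i)%R)
    (X_exp : forall (i : 'I_n) (t : R), (0 < t)%R ->
       reliability P (X i) t = (expR (- (lambda i * t)))%:E) :
  let lam (S : {set 'I_n}) : R := (\sum_(i in S) lambda i)%R in
  expectation_ext P (fun w => p (fun i => X i w)) =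
  (p (evec R finset.set0))%:num +
  \sum_(S : {set 'I_n} | S != finset.set0)
    \sum_(T : {set 'I_n} | T \subset S)
      ((-1) ^+ (#|S| - #|T|))%:E *
      ((1 - expeR (- ((lam S)%:E * (p (evec R T))%:num))) / (lam S)%:E).
Proof.
move=> lam.
pose c (S : {set 'I_n}) : \bar R := (p (evec R S))%:num.
have c_ge0 S : 0 <= c S by exact: lattice_ge0.
have lam_gt0 (S : {set 'I_n}) : S != finset.set0 -> (0 < lam S)%R.
  case/finset.set0Pn => i iS; rewrite /lam (bigD1 i)//=.
  by rewrite ltr_wpDr// sumr_ge0// => j _; exact: ltW.
have Y_meas : measurable_fun setT (fun w => (p (X ^~ w))%:num : \bar R).
  exact: measurable_wlp.
(* An infinite p(e_set0) would make the S = set0 integrand non-integrable and block the exchange of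
   integral and signed sum, so this case is treated apart. *)
have [c0y|c0y] := eqVneq (c finset.set0) +oo.
  transitivity (\int[P]_w (cst +oo : Omega -> \bar R) w).
    apply: eq_integral => w _; apply/eqP; rewrite -leye_eq -c0y.
    exact: wlp_evec0_le.
  rewrite integral_cst//= probability_setT mule1 -/(c _) c0y addye//.
  (* The +oo absorbs the signed sum provided the latter is not -oo; in fact every term is finite. *)
  suff : \sum_(S : {set 'I_n} | S != finset.set0)
    \sum_(U : {set 'I_n} | U \subset S) ((-1) ^+ (#|S| - #|U|))%:E *
      ((1 - expeR (- ((lam S)%:E * c U))) / (lam S)%:E) \is a fin_num.
    by move=> /fin_numPlt/andP[+ _]; rewrite ltNye.
  apply/sum_fin_numP => S _ S0; apply/sum_fin_numP => U _ _.
  by rewrite fin_numM// fin_num_expeR_quot// lam_gt0.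
pose mu : {measure set _ -> \bar R} := @lebesgue_measure R.
pose K S U (t : R) := (\1_(lt_set (c U)) t * expR (- (lam S * t)))%:E.
have K0E t : K finset.set0 finset.set0 t = (\1_(lt_set (c finset.set0)) t)%:E.
  by rewrite /K /lam big_set0 mul0r oppr0 expR0 mulr1.
have K_int (S U : {set 'I_n}) : U \subset S ->
    mu.-integrable `]0%R, +oo[ (K S U).
  (* For S = set0 the rate is 0 and there is no decay: integrability comes from the finiteness of
     p(e_set0). *)
  have [->|S0 _] := eqVneq S finset.set0; last first.
    by apply: integrable_expR_lt_set => //; exact: lam_gt0.
  rewrite finset.subset0 => /eqP ->.
  rewrite (_ : K _ _ = EFin \o \1_(lt_set (c finset.set0)));
    last exact/funext/K0E.
  apply: integrable_ge0_fin => //.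
    by apply: measurable_indic; exact: measurable_lt_set.
  by rewrite integral_indic_lt_set// ge0_fin_numE// ltey.
(* Extension by 0 makes both sums unconditional before they are exchanged with the integral. *)
pose F (S U : {set 'I_n}) (t : R) := if U \subset S
  then ((-1) ^+ (#|S| - #|U|))%:E * K S U t else 0.
have F_int S U : mu.-integrable `]0%R, +oo[ (F S U).
  rewrite /F; have [US|_] := boolP (U \subset S); last exact: integrable0.
  by apply: integrableZl => //; exact: K_int.
transitivity (\int[mu]_(t in `]0%R, +oo[)
    \sum_(S : {set 'I_n}) \sum_(U : {set 'I_n}) F S U t).
  rewrite /expectation_ext ge0_integral_tail//.
  apply: eq_integral => t; rewrite inE /= in_itv /= andbT => t0.
  rewrite (wlp_tail _ p_wlp)// ?ltW//; apply: eq_bigr => S _.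
  rewrite (reliability_series S X_indep (fun i => X_exp i t t0)).
  rewrite -EFinM mulr_suml -sumEFin big_mkcond /=.
  by apply: eq_bigr => U _; rewrite /F; case: ifP => // _; rewrite -EFinM mulrA.
rewrite integral_sum//; last by move=> S; apply: integrable_sum.
have FE S : \int[mu]_(t in `]0%R, +oo[) (\sum_(U : {set 'I_n}) F S U t) =
  \sum_(U : {set 'I_n} | U \subset S) ((-1) ^+ (#|S| - #|U|))%:E *
    \int[mu]_(t in `]0%R, +oo[) K S U t.
  rewrite integral_sum// [RHS]big_mkcond /=; apply: eq_bigr => U _.
  rewrite /F; have [US|_] := boolP (U \subset S); last exact: integral0.
  by rewrite integralZl//; exact: K_int.
(* The S = set0 summand has the single subset U = set0 and rate 0; it integrates to p(e_set0). *)
rewrite (bigD1 finset.set0)//=; congr (_ + _).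
  rewrite FE (big_pred1 finset.set0) => [|U]; last by rewrite /= finset.subset0.
  rewrite subnn expr0 mul1e; under eq_integral do rewrite K0E.
  exact: integral_indic_lt_set.
apply: eq_bigr => S S0; rewrite FE; apply: eq_bigr => U _; congr (_ * _).
by rewrite integral_expR_lt_set// lam_gt0.
Qed.
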